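(* Let $A$ and $B$ be unital C$^*$-algebras with $B$ finite, and let $\varphi,\psi:A\to B$ be bounded linear maps such that $\varphi(a)\psi(b)=0$ whenever $a,b\in A$ satisfy $ab=0$. Suppose that both $\varphi(A)$ and $\psi(A)$ contain invertible elements. Then there exists an (algebra) homomorphism $\rho:A\to B$ such that $\varphi(a)=\varphi(1)\rho(a)$ and $\psi(a)=\rho(a)\psi(1)$ for all $a\in A$.
   Context: A unital C$^*$-algebra $B$ is finite if it is Dedekind-finite, i.e. every one-sided invertible element of $B$ is invertible. *)

(* Defs.v *)
(* Complex scalars: complex R = R[i] (mathcomp-real-closed)
   for R : realType.  Unital C*-algebras are given as a complete normed space over
   C together with an explicit multiplication, unit and involution satisfying the
   C*-algebra axioms (operator algebras are not in the library). *)
From HB Require Import structures.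
From mathcomp Require Import all_boot all_order all_algebra.
From mathcomp Require Import all_classical all_reals all_analysis.
From mathcomp Require Import complex.
Import numFieldNormedType.Exports.
Import Order.TTheory GRing.Theory Num.Theory.
Local Open Scope ring_scope.

Set Implicit Arguments.
Unset Strict Implicit.
Unset Printing Implicit Defensive.

(* The axioms of a unital C*-algebra on a complex Banach space V, with
   multiplication [mul], unit [one] and involution [star]. *)
Record unital_cstar_algebra (R : realType) (V : completeNormedModType (complex R))
    (mul : V -> V -> V) (one : V) (star : V -> V) : Prop := {
  cs_mulA : forall x y z, mul x (mul y z) = mul (mul x y) z;
  cs_mul1l : forall x, mul one x = x;
  cs_mul1r : forall x, mul x one = x;
  cs_mulDl : forall x y z, mul (x + y) z = mul x z + mul y z;
  cs_mulDr : forall x y z, mul x (y + z) = mul x y + mul x z;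
  cs_mulZl : forall (c : complex R) x y, mul (c *: x) y = c *: mul x y;
  cs_mulZr : forall (c : complex R) x y, mul x (c *: y) = c *: mul x y;
  cs_starD : forall x y, star (x + y) = star x + star y;
  cs_starZ : forall (c : complex R) x, star (c *: x) = (c^*) *: star x;
  cs_starK : forall x, star (star x) = x;
  cs_starM : forall x y, star (mul x y) = mul (star y) (star x);
  cs_norm_mul : forall x y, `|mul x y| <= `|x| * `|y|;
  cs_cstar : forall x, `|mul (star x) x| = `|x| ^+ 2
}.

(* x is (two-sided) invertible *)
Definition invertible (R : realType) (V : completeNormedModType (complex R))
    (mul : V -> V -> V) (one : V) (x : V) : Prop :=
  exists y, mul x y = one /\ mul y x = one.

(* Dedekind-finite: every one-sided invertible element is invertible *)
Definition finite_alg (R : realType) (V : completeNormedModType (complex R))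
    (mul : V -> V -> V) (one : V) : Prop :=
  forall x, (exists y, mul x y = one) \/ (exists y, mul y x = one) ->
    invertible mul one x.

(* complex-linear maps *)
Definition clinear (R : realType) (U V : completeNormedModType (complex R))
    (f : U -> V) : Prop :=
  forall (c : complex R) x y, f (c *: x + y) = c *: f x + f y.

(* bounded (= continuous) linear maps *)
Definition bounded_linear (R : realType) (U V : completeNormedModType (complex R))
    (f : U -> V) : Prop :=
  clinear f /\ exists M : R, forall x, `|f x| <= (M%:C)%C * `|x|.

(* (not necessarily unital) algebra homomorphisms *)
Definition alg_hom (R : realType) (U V : completeNormedModType (complex R))
    (mulU : U -> U -> U) (mulV : V -> V -> V) (f : U -> V) : Prop :=
  clinear f /\ forall x y, f (mulU x y) = mulV (f x) (f y).

(* Main.v *)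
(* The whole point is that [phi (a b) psi 1 = phi a psi b].  Both sides are linear in
   [b] and every element is a combination of unitaries ([b + i sqrt (1 - b^2)] is
   unitary for a selfadjoint contraction [b]), so consider a bounded bilinear [T] with
   [T x y = 0] whenever [x y = 0], and a unitary [u]; the claim becomes
   [T u 1 = T 1 u].

   For [|z| = 1] let [c = Re (z u)] and [s = |c| = sqrt (1 - Im (z u)^2)], a norm limit
   of polynomials by the binomial series.  As [(s + c) (s - c) = 0 = (s - c) (s + c)],
   [T c s = T s c].  Averaging [z^-1 (T c s - T s c)] over the roots of unity [z] leaves
   only the Fourier coefficients of order 0 and 2 of [|cos|], which are in the ratio
   3 : 1, and yields
     [3 (T u 1 - T 1 u) + T u^-1 u^2 - T u^2 u^-1 = 0].
   Applied to the forms [T (u^k x) (y u^-l)], this says that the sequence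
   [T u^k (u^-k u)] has vanishing third differences; being bounded it is constant.

   Finally [phi a psi b = phi (a b) psi 1 = phi 1 psi (a b)], so [psi 1] and [phi 1] are
   one-sided invertible, hence invertible, and [rho = (phi 1)^-1 phi]. *)
Require Import Defs.
From HB Require Import structures.
From mathcomp Require Import all_boot all_order all_algebra.
From mathcomp Require Import all_classical all_reals all_analysis.
From mathcomp Require Import complex ring zify.
Import numFieldNormedType.Exports.
Import Order.TTheory GRing.Theory Num.Theory.
Local Open Scope ring_scope.

Set Implicit Arguments.
Unset Strict Implicit.
Unset Printing Implicit Defensive.

(** * Coefficients of the square root series *)

Section CentralBinomial.
Variable F : numFieldType.

(** These are the coefficients of [(1 - x)^(-1/2)], and also the means of [sin^(2k)] over the
    circle. *)
Definition cbin (k : nat) : F := 'C(k.*2, k)%:R / 4 ^+ k.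

(* [sqrt (1 - x) = \sum_k sqrt_coef k * x ^+ k] *)
Definition sqrt_coef (k : nat) : F := cbin k / (1 - k.*2%:R).

Lemma central_binS k :
  (k.+1 * 'C(k.+1.*2, k.+1) = 2 * (k.*2.+1) * 'C(k.*2, k))%N.
Proof.
have h1 := mul_bin_diag k.+1.*2 k; have h2 := mul_bin_down k.*2.+1 k.
rewrite doubleS /= in h1 *; rewrite /= in h2.
have e : (k.*2.+1 - k = k.+1)%N by lia.
rewrite e in h2; nia.
Qed.

Lemma one_sub_double_neq0 k : 1 - k.*2%:R != 0 :> F.
Proof. by rewrite subr_eq0 eq_sym (eqr_nat F k.*2 1); case: k => [|[]]. Qed.

Lemma cbinS k : cbin k.+1 * k.+1.*2%:R = cbin k * k.*2.+1%:R.
Proof.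
have h4 : (4 : F) ^+ k != 0 by rewrite expf_neq0 ?pnatr_eq0.
have hk : k.+1%:R != 0 :> F by rewrite pnatr_eq0.
have h : k.+1%:R * 'C(k.+1.*2, k.+1)%:R = 2 * k.*2.+1%:R * 'C(k.*2, k)%:R :> F.
  by rewrite -!natrM central_binS.
rewrite /cbin exprS.
have -> : 'C(k.+1.*2, k.+1)%:R = 2 * k.*2.+1%:R * 'C(k.*2, k)%:R / k.+1%:R :> F.
  by rewrite -h mulrAC mulfV ?mul1r.
rewrite -[_.*2 in X in _ * X = _]muln2 natrM.
by field; rewrite h4 addrC natr1 hk.
Qed.

Lemma cbin0 : cbin 0 = 1.
Proof. by rewrite /cbin bin0 expr0 divr1. Qed.

Lemma cbin_gt0 k : 0 < cbin k.
Proof.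
by rewrite divr_gt0 ?exprn_gt0 ?ltr0n // bin_gt0 -addnn leq_addr.
Qed.

Lemma cbinS_frac k : cbin k.+1 = cbin k * k.*2.+1%:R / k.+1.*2%:R.
Proof. by rewrite -cbinS mulfK // pnatr_eq0 doubleS. Qed.

Lemma cbin_le k l : (k <= l)%N -> cbin l <= cbin k.
Proof.
move=> /subnK <-; elim: (l - k)%N => [|n IHn]; first by rewrite add0n.
apply: le_trans IHn; rewrite addSn cbinS_frac ler_pdivrMr ?ltr0n ?doubleS //.
by rewrite ler_pM2l ?cbin_gt0 // ler_nat.
Qed.

Lemma cbin_le1 k : cbin k <= 1.
Proof. by rewrite -cbin0 cbin_le. Qed.

(** The left side decreases in [k] because [(2k+1)(2k+3) < (2k+2)^2]. It yields the decay of [cbin],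
    which serves as the error scale everywhere below. *)
Lemma cbin_sqr_le k : cbin k ^+ 2 * k.*2.+1%:R <= 1.
Proof.
elim: k => [|k IHk]; first by rewrite cbin0 expr1n mul1r.
apply: le_trans IHk.
have h2 : (0 : F) < k.+1.*2%:R by rewrite ltr0n.
have e : cbin k.+1 ^+ 2 * k.+1.*2.+1%:R * k.+1.*2%:R ^+ 2 =
    cbin k ^+ 2 * (k.*2.+1 ^ 2 * k.+1.*2.+1)%N%:R.
  by rewrite mulrAC -exprMn cbinS natrM natrX; ring.
rewrite -(ler_pM2r (exprn_gt0 2 h2)) e.
rewrite -[leRHS]mulrA ler_wpM2l ?exprn_ge0 ?ltW ?cbin_gt0 //.
by rewrite -natrX -natrM ltr_nat doubleS; nia.
Qed.

Lemma sqrt_coef0 : sqrt_coef 0 = 1.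
Proof. by rewrite /sqrt_coef cbin0 double0 subr0 divr1. Qed.

(** Coefficient form of [sqrt (1 - x) = (1 - x) (1 - x)^(-1/2)]; it makes partial sums telescope. *)
Lemma sqrt_coefE k : sqrt_coef k.+1 = cbin k.+1 - cbin k.
Proof.
apply: (mulIf (one_sub_double_neq0 k.+1)).
rewrite /sqrt_coef divfK ?one_sub_double_neq0 //.
have e : k.+1.*2%:R = k.*2.+1%:R + 1 :> F by rewrite natr1 doubleS.
have := cbinS k; rewrite e => h.
transitivity (cbin k.+1 * (k.*2.+1%:R + 1) - cbin k.+1 * k.*2.+1%:R); first by ring.
by rewrite h; ring.
Qed.

Lemma sqrt_coefS_le0 k : sqrt_coef k.+1 <= 0.
Proof. by rewrite sqrt_coefE subr_le0 cbin_le. Qed.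

Lemma sum_sqrt_coef K : \sum_(k < K.+1) sqrt_coef k = cbin K.
Proof.
elim: K => [|K IH]; first by rewrite big_ord1 sqrt_coef0 cbin0.
by rewrite big_ord_recr /= IH sqrt_coefE; ring.
Qed.

Lemma sum_norm_sqrt_coef K L : (K <= L)%N ->
  \sum_(K.+1 <= k < L.+1) `|sqrt_coef k| = cbin K - cbin L.
Proof.
move=> /subnK <-; elim: (L - K)%N => [|n IHn].
  by rewrite add0n big_geq // subrr.
rewrite addSn big_nat_recr /=; last by rewrite ltnS leq_addl.
by rewrite IHn ler0_norm ?sqrt_coefS_le0 // sqrt_coefE; ring.
Qed.

Lemma sqrt_coefS k :
  sqrt_coef k.+1 * k.+1.*2%:R = sqrt_coef k * (k.*2%:R - 1).
Proof.
rewrite mulrBr mulr1.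
have -> : sqrt_coef k * k.*2%:R = sqrt_coef k - sqrt_coef k * (1 - k.*2%:R) by ring.
rewrite {3}/sqrt_coef divfK ?one_sub_double_neq0 //.
rewrite sqrt_coefE mulrBl cbinS doubleS.
have -> : k.*2.+2%:R = k.*2.+1%:R + 1 :> F by rewrite natr1.
ring.
Qed.

(** The formal square of the series is [1 - x]. The symmetry [i <-> n - i] and [sqrt_coefS] give
    [(n+1) d (n+1) = (n-1) d n] for the convolution [d], which therefore vanishes from index 2
    on. *)
Lemma sqrt_coef_conv m :
  \sum_(i < m.+1) sqrt_coef i * sqrt_coef (m - i) = (m == 0%N)%:R - (m == 1%N)%:R.
Proof.
pose d m := \sum_(i < m.+1) sqrt_coef i * sqrt_coef (m - i).
have wE n : \sum_(i < n.+1) i.*2%:R * (sqrt_coef i * sqrt_coef (n - i)) = n%:R * d n.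
  have e1 : \sum_(i < n.+1) i%:R * (sqrt_coef i * sqrt_coef (n - i))
     = \sum_(i < n.+1) (n - i)%:R * (sqrt_coef i * sqrt_coef (n - i)).
    rewrite (reindex_inj rev_ord_inj) /=; apply: eq_bigr => i _.
    have hi := ltn_ord i.
    by rewrite subSS subKn // ?[sqrt_coef (n - i) * _]mulrC.
  rewrite /d mulr_sumr.
  transitivity (\sum_(i < n.+1) i%:R * (sqrt_coef i * sqrt_coef (n - i)) +
                \sum_(i < n.+1) i%:R * (sqrt_coef i * sqrt_coef (n - i))).
    by rewrite -big_split /=; apply: eq_bigr => i _; rewrite -addnn natrD mulrDl.
  rewrite {2}e1 -big_split /=; apply: eq_bigr => i _.
  by rewrite -mulrDl -natrD subnKC // -ltnS.
have dS n : n.+1%:R * d n.+1 = (n%:R - 1) * d n.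
  rewrite -wE big_ord_recl /= mul0r add0r mulrBl mul1r -wE /d -sumrB.
  apply: eq_bigr => i _; rewrite /bump add1n subSS mulrA [_%:R * _]mulrC sqrt_coefS.
  ring.
have d0 : d 0%N = 1 by rewrite /d big_ord1 sqrt_coef0 mulr1.
have d1 : d 1%N = -1 by have := dS 0%N; rewrite d0 sub0r mul1r mulr1.
have dSS n : d n.+2 = 0.
  elim: n => [|n IHn]; first by
    have := dS 1%N; rewrite subrr mul0r => /eqP; rewrite mulf_eq0 pnatr_eq0 /= => /eqP.
  by have := dS n.+2; rewrite IHn mulr0 => /eqP; rewrite mulf_eq0 pnatr_eq0 /= => /eqP.
rewrite -/(d m); case: m => [|[|m]]; rewrite ?d0 ?d1 ?dSS /= ?subr0 ?sub0r ?subrr //.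
Qed.

(* The two sums are the Fourier coefficients of orders 0 and 2 of the
   truncated expansion of [|cos| = sqrt (1 - sin ^ 2)]. *)
Definition fourier0 K := \sum_(k < K.+1) sqrt_coef k * cbin k.
Definition fourier2 K := - \sum_(k < K.+1) sqrt_coef k * (cbin k * k%:R / k.+1%:R).

(** The ratio 3 : 1 up to an explicit error: the truncated defect has a closed form, verified by
    induction, and it tends to 0 with [cbin K]. *)
Lemma fourier_relation K :
  fourier0 K - 3 * fourier2 K = K.*2.+1%:R / K.+1%:R * cbin K ^+ 2.
Proof.
elim: K => [|K IH].
  rewrite /fourier0 /fourier2 !big_ord1 sqrt_coef0 cbin0 /=.
  by rewrite !(mulr1, mul1r, mulr0, mul0r) oppr0 mulr0 subr0 expr1n invr1 mulr1.
have -> : fourier0 K.+1 - 3 * fourier2 K.+1 = fourier0 K - 3 * fourier2 K +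
   (sqrt_coef K.+1 * cbin K.+1 + 3 * (sqrt_coef K.+1 * (cbin K.+1 * K.+1%:R / K.+2%:R))).
  by rewrite /fourier0 /fourier2 big_ord_recr [in X in - X]big_ord_recr /=; ring.
rewrite IH /sqrt_coef cbinS_frac.
have e1 : K.+1%:R = 1 + K%:R :> F by rewrite nat1r.
have e2 : K.+2%:R = 2 + K%:R :> F by rewrite -(natrD F 2 K).
have e3 : K.*2.+1%:R = 1 + 2 * K%:R :> F by rewrite -natrM -(natrD F 1) mul2n.
have e4 : K.+1.*2%:R = 2 + 2 * K%:R :> F by rewrite -natrM -(natrD F 2) mul2n.
have e5 : K.+1.*2.+1%:R = 3 + 2 * K%:R :> F by rewrite -natrM -(natrD F 3) mul2n.
have h1 : 1 + K%:R != 0 :> F by rewrite -e1 pnatr_eq0.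
have h2 : 2 + K%:R != 0 :> F by rewrite -e2 pnatr_eq0.
have h4 : 2 + 2 * K%:R != 0 :> F by rewrite -e4 pnatr_eq0.
have h5 : 1 - (2 + 2 * K%:R) != 0 :> F by rewrite -e4 one_sub_double_neq0.
rewrite e1 e2 e3 e4 e5.
by field; rewrite ?h1 ?h2 ?h4 ?h5 // .
Qed.

(** Every term contributes a nonnegative amount and the term [k = 1] is exactly [1/8]. This uniform
    bound allows division by [fourier2 K] in the limit. *)
Lemma fourier2_ge K : (0 < K)%N -> 8^-1 <= fourier2 K.
Proof.
case: K => // K _; rewrite /fourier2 2!big_ord_recl /=.
rewrite sqrt_coefE cbin0 /= mulr0 mul0r mulr0 add0r opprD -[leLHS]addr0.
have -> : cbin 1 = 2^-1.
  by rewrite cbinS_frac cbin0 !mul1r.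
apply: lerD.
  have -> : 8^-1 = - ((2^-1 - 1) * (2^-1 * 1 / 2)) :> F by field.
  exact: lexx.
rewrite -sumrN sumr_ge0 // => i _; rewrite -mulNr mulr_ge0 ?oppr_ge0 ?sqrt_coefS_le0 //.
by rewrite divr_ge0 ?ler0n // mulr_ge0 ?ler0n // ltW ?cbin_gt0.
Qed.

End CentralBinomial.

(** * Limit arguments over the complex scalars, and roots of unity *)

Section Limits.
Variable R : realType.
Local Notation C := (complex R).

Lemma complex_archi_eq0 (y E : C) : 0 <= y -> (forall n : nat, y *+ n <= E) -> y = 0.
Proof.
move=> y0 hy; have Imy := ger0_Im y0.
have Rey : 0 <= complex.Re y by move: y0; rewrite lecE => /andP[].
have hR n : complex.Re y *+ n <= complex.Re E.
  have := hy n; rewrite lecE => /andP[_].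
  suff -> : complex.Re (y *+ n) = complex.Re y *+ n by [].
  by elim: n => // n IHn; rewrite !mulrS -IHn; case: (y) (y *+ n) => a b [].
suff Rey0 : complex.Re y = 0 by move: Imy Rey0; case: (y) => a b /= -> ->.
apply/eqP; rewrite eq_le Rey andbT leNgt; apply/negP => ylt0.
have E0 : 0 <= complex.Re E by have := hR 0%N; rewrite mulr0n.
have := archi_boundP (divr_ge0 E0 Rey).
rewrite ltr_pdivrMr // mulr_natl => h.
by have := lt_le_trans h (hR _); rewrite ltxx.
Qed.

(** The squeeze argument behind all later limits. Squaring turns [cbin_sqr_le] into a bound on the
    multiples of [x ^+ 2], so the Archimedean property applies. *)
Lemma le_cbin_eq0 (x D : C) : 0 <= x -> (forall K : nat, x <= D * cbin C K) -> x = 0.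
Proof.
move=> x0 hx; apply/eqP; have /= <- := expf_eq0 x 2; apply/eqP.
have D0 : 0 <= D by have := hx 0%N; rewrite cbin0 mulr1; exact: le_trans.
apply: (@complex_archi_eq0 _ (D ^+ 2)) => [|n]; first exact: exprn_ge0.
have h : x ^+ 2 <= D ^+ 2 * cbin C n ^+ 2.
  by rewrite -exprMn; apply: lerXn2r; rewrite ?nnegrE ?mulr_ge0 ?(ltW (cbin_gt0 _ _)).
rewrite -mulr_natr; apply: (@le_trans _ _ (x ^+ 2 * n.*2.+1%:R)).
  by rewrite ler_wpM2l ?exprn_ge0 // ler_nat; lia.
apply: (@le_trans _ _ (D ^+ 2 * cbin C n ^+ 2 * n.*2.+1%:R)); first exact: ler_wpM2r.
by rewrite -mulrA ler_piMr ?exprn_ge0 // cbin_sqr_le.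
Qed.

Lemma cbin_small (d : C) : 0 < d -> exists n, cbin C n < d.
Proof.
move=> d0; apply: contrapT => h; move: (d0); rewrite (@le_cbin_eq0 d 1) ?ltxx ?ltW // => K.
rewrite mul1r; have [//|hK] := real_leP (gtr0_real d0) (gtr0_real (cbin_gt0 C K)).
by case: h; exists K.
Qed.

Lemma cauchy_cbin_lim (V : completeNormedModType C) (s : nat -> V) :
  (forall n m : nat, (n <= m)%N -> `|s m - s n| <= cbin C n) ->
  exists l, forall n, `|l - s n| <= cbin C n *+ 2.
Proof.
move=> hs.
have : cvg (s @ \oo)%classic.
  apply/cauchy_cvgP; apply: cauchy_exP => eps /cbin_small [N hN].
  exists (s N); exists N => // m /= Nm; rewrite -ball_normE /= distrC.
  exact: le_lt_trans (hs _ _ Nm) hN.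
case/cvg_ex => l /cvgrPdist_lt hl; exists l => n.
have [N _ hN] := hl _ (cbin_gt0 C n).
have hm := hN (maxn N n) (leq_maxl _ _).
have hn := hs n (maxn N n) (leq_maxr _ _).
have -> : l - s n = (l - s (maxn N n)) + (s (maxn N n) - s n) by rewrite addrA subrK.
by rewrite mulr2n; apply: le_trans (ler_normD _ _) (lerD (ltW hm) hn).
Qed.

(** A [2^m]-th root of [-1] has order dividing [2^(m+1)] but not [2^m]. Orders that are powers of 2
    suffice, since the averages only need [N] large. *)
Lemma prim_root_exp2_exists m : exists z : C, (2 ^ m.+1).-primitive_root z.
Proof.
pose z : C := (2 ^ m).-root (-1).
have zE : z ^+ (2 ^ m) = -1 by rewrite rootCK // expn_gt0.
have z1 : z ^+ (2 ^ m.+1) = 1 by rewrite expnSr exprM zE sqrrN expr1n.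
have [d dz] := prim_order_exists (expn_gt0 2 m.+1) z1.
move=> /(dvdn_pfactor _ _ (isT : prime 2)) [j jm dE]; exists z.
have [jm1|] := eqVneq j m.+1; first by rewrite -jm1 -dE.
move=> jm1; have : (j <= m)%N by lia.
move=> /(dvdn_exp2l 2); rewrite -dE.
rewrite (prim_order_dvd dz) zE => /eqP /esym /eqP.
by rewrite -subr_eq0 opprK (eqr_nat C 2 0).
Qed.

(** Vanishing second differences make [f] affine in [k], and a bounded affine sequence has slope
    0. *)
Lemma bounded_diff2_const (V : normedModType C) (f : nat -> V) (M : C) :
  (forall k, `|f k| <= M) -> (forall k, f k.+2 - f k.+1 = f k.+1 - f k) ->
  forall k, f k.+1 = f k.
Proof.
move=> hM hf.
have hd k : f k.+1 - f k = f 1%N - f 0%N by elim: k => // k <-.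
have hlin k : f k - f 0%N = (f 1%N - f 0%N) *+ k.
  elim: k => [|k IHk]; first by rewrite subrr.
  by rewrite mulrS -IHk -(hd k) addrA subrK.
have h0 : f 1%N - f 0%N = 0.
  apply/eqP; rewrite -normr_eq0; apply/eqP.
  apply: (@complex_archi_eq0 _ (M + M)) => // n.
  rewrite -normrMn -hlin; apply: le_trans (ler_normB _ _) _; exact: lerD.
by move=> k; apply/eqP; rewrite -subr_eq0 hd h0.
Qed.

Lemma bounded_diff3_const (V : normedModType C) (f : nat -> V) (M : C) :
  (forall k, `|f k| <= M) ->
  (forall k, (f k.+3 - f k.+2) - (f k.+2 - f k.+1) = (f k.+2 - f k.+1) - (f k.+1 - f k)) ->
  forall k, f k.+1 = f k.
Proof.
move=> hM hf; apply: (bounded_diff2_const hM).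
apply: (@bounded_diff2_const _ (fun k => f k.+1 - f k) (M + M)) => // k.
by apply: le_trans (ler_normB _ _) _; exact: lerD.
Qed.

End Limits.

(** * Square roots and unitaries in a C*-algebra *)

(* A copy of the carrier on which [mul] is the ring product; [one != 0] is required by
   [horner_alg], which is only available in nontrivial algebras. *)
Definition cstar_type (R : realType) (A : completeNormedModType (complex R))
  (mul : A -> A -> A) (one : A) (star : A -> A)
  (hA : unital_cstar_algebra mul one star) (h1 : one != 0) : Type := A.

Section Instances.
Variables (R : realType) (A : completeNormedModType (complex R)).
Variables (mul : A -> A -> A) (one : A) (star : A -> A).
Variables (hA : unital_cstar_algebra mul one star) (h1 : one != 0).
Local Notation T := (cstar_type hA h1).

HB.instance Definition _ := CompleteNormedModule.copy T A.
HB.instance Definition _ := GRing.Zmodule_isNzRing.Build T (cs_mulA hA) (cs_mul1l hA)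
  (cs_mul1r hA) (cs_mulDl hA) (cs_mulDr hA) h1.
Fact cstar_scaleAl (c : complex R) (x y : T) : c *: (x * y) = (c *: x) * y.
Proof. exact: esym (cs_mulZl hA c x y). Qed.
HB.instance Definition _ :=
  GRing.Lmodule_isLalgebra.Build (complex R) T cstar_scaleAl.
Fact cstar_scaleAr (c : complex R) (x y : T) : c *: (x * y) = x * (c *: y).
Proof. exact: esym (cs_mulZr hA c x y). Qed.
HB.instance Definition _ :=
  GRing.Lalgebra_isAlgebra.Build (complex R) T cstar_scaleAr.

End Instances.

Section CstarAlgebra.
Variables (R : realType) (A0 : completeNormedModType (complex R)).
Variables (mul : A0 -> A0 -> A0) (one : A0) (involA : A0 -> A0).
Variables (hA : unital_cstar_algebra mul one involA) (h1 : one != 0).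
Local Notation C := (complex R).
Local Notation A := (cstar_type hA h1).

Definition star (x : A) : A := involA x.

Lemma starD (x y : A) : star (x + y) = star x + star y.
Proof. exact: (cs_starD hA). Qed.
Lemma starZ c (x : A) : star (c *: x) = c^* *: star x.
Proof. exact: (cs_starZ hA). Qed.
Lemma starK (x : A) : star (star x) = x.
Proof. exact: (cs_starK hA). Qed.
Lemma starM (x y : A) : star (x * y) = star y * star x.
Proof. exact: (cs_starM hA). Qed.
Lemma normM_le (x y : A) : `|x * y| <= `|x| * `|y|.
Proof. exact: (cs_norm_mul hA). Qed.
Lemma norm_starM (x : A) : `|star x * x| = `|x| ^+ 2.
Proof. exact: (cs_cstar hA). Qed.

Lemma star0 : star 0 = 0.
Proof. by apply: (@addrI _ (star 0)); rewrite -starD !addr0. Qed.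
Lemma starN x : star (- x) = - star x.
Proof. by apply: (@addrI _ (star x)); rewrite -starD !subrr star0. Qed.
Lemma star1 : star 1 = 1.
Proof. by rewrite -[RHS]starK -[star 1 in RHS]mulr1 starM starK mulr1. Qed.
Lemma starX x n : star (x ^+ n) = star x ^+ n.
Proof. by elim: n => [|n IHn]; rewrite ?star1 // exprS exprSr starM IHn. Qed.
Lemma star_sum I (r : seq I) (F : I -> A) :
  star (\sum_(i <- r) F i) = \sum_(i <- r) star (F i).
Proof. exact: (big_morph star starD star0). Qed.

Lemma norm1 : `|1 : A| = 1.
Proof.
have := norm_starM 1; rewrite star1 mulr1 expr2 => h.
have n0 : `|1 : A| != 0 by rewrite normr_eq0 oner_eq0.
by apply: (mulIf n0); rewrite mul1r -h.
Qed.

Lemma norm_star x : `|star x| = `|x|.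
Proof.
have le y : `|y| <= `|star y|.
  have [->|y0] := eqVneq y 0; first by rewrite normr0.
  rewrite -(@ler_pM2r _ `|y|) ?normr_gt0 // -expr2 -norm_starM; exact: normM_le.
by apply: le_anti; rewrite le andbT -[X in _ <= `|X|]starK le.
Qed.

Lemma normX_le1 (x : A) n : `|x| <= 1 -> `|x ^+ n| <= 1.
Proof.
move=> hx; elim: n => [|n IHn]; first by rewrite expr0 norm1.
by rewrite exprS; apply: le_trans (normM_le _ _) _; rewrite mulr_ile1.
Qed.

Lemma horner_algE (x : A) (p : {poly C}) n : (size p <= n)%N ->
  horner_alg x p = \sum_(i < n) p`_i *: x ^+ i.
Proof.
move=> hn; rewrite /horner_alg /horner_morph (horner_coef_wide _ (n := n)).
  by apply: eq_bigr => i _; rewrite coef_map /= mulr_algl.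
exact: leq_trans (size_poly _ _) hn.
Qed.

Lemma norm_horner_alg_le (x : A) (p : {poly C}) n : (size p <= n)%N -> `|x| <= 1 ->
  `|horner_alg x p| <= \sum_(i < n) `|p`_i|.
Proof.
move=> hn hx; rewrite (horner_algE x hn); apply: le_trans (ler_norm_sum _ _ _) _.
apply: ler_sum => i _; rewrite normrZ ler_piMr //; exact: normX_le1.
Qed.

(** * Polynomial approximation of the square root of [1 - x] *)

Definition sqrt_poly (K : nat) : {poly C} := \poly_(k < K.+1) sqrt_coef C k.

Lemma size_sqrt_poly K : (size (sqrt_poly K) <= K.+1)%N.
Proof. exact: size_poly. Qed.

Lemma horner_alg_sqrt_poly K (x : A) :
  horner_alg x (sqrt_poly K) = \sum_(k < K.+1) sqrt_coef C k *: x ^+ k.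
Proof.
rewrite (horner_algE x (size_sqrt_poly K)); apply: eq_bigr => i _.
by rewrite coef_poly ltn_ord.
Qed.

Lemma sqrt_poly_eval1 K : (sqrt_poly K).[1] = cbin C K.
Proof.
rewrite (horner_coef_wide _ (size_sqrt_poly K)) -sum_sqrt_coef.
by apply: eq_bigr => i _; rewrite coef_poly ltn_ord expr1n mulr1.
Qed.

(** Up to degree [K] the coefficients cancel by [sqrt_coef_conv]; beyond it only products of two
    nonpositive coefficients remain. *)
Lemma coef_sqrt_poly_sqr_err_ge0 K m : (0 < K)%N ->
  0 <= (sqrt_poly K ^+ 2 - (1 - 'X))`_m.
Proof.
move=> K0; rewrite expr2 !coefB coef1 coefX coefM.
have [mK|Km] := leqP m K.
  have -> : \sum_(j < m.+1) (sqrt_poly K)`_j * (sqrt_poly K)`_(m - j) =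
     \sum_(j < m.+1) sqrt_coef C j * sqrt_coef C (m - j).
    apply: eq_bigr => i _; have hi := ltn_ord i.
    by rewrite !coef_poly !ifT //; lia.
  by rewrite sqrt_coef_conv subrr.
have -> : (m == 0%N) = false by lia.
have -> : (m == 1%N) = false by lia.
rewrite !subr0; apply: sumr_ge0 => i _; rewrite !coef_poly.
have [iK|] := ifP; last by rewrite mul0r.
have [miK|] := ifP; last by rewrite mulr0.
have i0 : (0 < i)%N by lia.
have mi0 : (0 < m - i)%N by lia.
rewrite mulr_le0 //.
  by case: (nat_of_ord i) i0 => // n _; rewrite sqrt_coefS_le0.
by case: (m - i)%N mi0 => // n _; rewrite sqrt_coefS_le0.
Qed.

(** Since the error polynomial has nonnegative coefficients, its norm at a contraction is at most
    its value at 1, where [1 - 'X] vanishes. *)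
Lemma norm_sqrt_poly_err (x : A) K : (0 < K)%N -> `|x| <= 1 ->
  `|horner_alg x (sqrt_poly K) ^+ 2 - (1 - x)| <= cbin C K ^+ 2.
Proof.
move=> K0 hx; set r := sqrt_poly K ^+ 2 - (1 - 'X).
have -> : horner_alg x (sqrt_poly K) ^+ 2 - (1 - x) = horner_alg x r.
  by rewrite /r rmorphB rmorphXn rmorphB rmorph1 /= horner_algX.
apply: le_trans (norm_horner_alg_le (leqnn _) hx) _.
rewrite (eq_bigr (fun i : 'I_(size r) => r`_i * 1 ^+ i)).
  by rewrite -horner_coef /r !hornerE sqrt_poly_eval1 subrr subr0.
by move=> i _; rewrite expr1n mulr1 ger0_norm ?coef_sqrt_poly_sqr_err_ge0.
Qed.

Lemma norm_sqrt_poly_sub (x : A) K L : (K <= L)%N -> `|x| <= 1 ->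
  `|horner_alg x (sqrt_poly L) - horner_alg x (sqrt_poly K)| <= cbin C K.
Proof.
move=> KL hx; rewrite !horner_alg_sqrt_poly.
rewrite -!(big_mkord xpredT (fun k => sqrt_coef C k *: x ^+ k)).
rewrite (@big_cat_nat _ _ _ K.+1 0 L.+1) //= addrAC subrr add0r.
apply: le_trans (ler_norm_sum _ _ _) _.
apply: (@le_trans _ _ (\sum_(K.+1 <= k < L.+1) `|sqrt_coef C k|)).
  by apply: ler_sum => i _; rewrite normrZ ler_piMr // normX_le1.
by rewrite sum_norm_sqrt_coef // gerBl ltW ?cbin_gt0.
Qed.

Lemma sqrt_one_sub_exists (x : A) : `|x| <= 1 ->
  exists s : A, forall K, `|s - horner_alg x (sqrt_poly K)| <= cbin C K *+ 2.
Proof.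
move=> hx; apply: (@cauchy_cbin_lim R A (fun K => horner_alg x (sqrt_poly K))) => n m nm.
exact: norm_sqrt_poly_sub.
Qed.

Lemma norm_sqrt_poly_le (x : A) K : `|x| <= 1 -> `|horner_alg x (sqrt_poly K)| <= 2.
Proof.
move=> hx; rewrite -[X in `|X|](subrK (horner_alg x (sqrt_poly 0))).
apply: le_trans (ler_normD _ _) _; apply: (@le_trans _ _ (1 + 1)) => //; apply: lerD.
  by apply: le_trans (norm_sqrt_poly_sub (leq0n K) hx) _; rewrite cbin0.
by rewrite horner_alg_sqrt_poly big_ord1 sqrt_coef0 scale1r norm1.
Qed.

Section Sqrt.
Variables x s : A.
Hypothesis x1 : `|x| <= 1.
Hypothesis hs : forall K, `|s - horner_alg x (sqrt_poly K)| <= cbin C K *+ 2.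

Lemma sqrt_one_sub_norm : `|s| <= 4.
Proof.
rewrite -[s](subrK (horner_alg x (sqrt_poly 0))).
apply: le_trans (ler_normD _ _) _; apply: (@le_trans _ _ (2 + 2)).
  by apply: lerD; [apply: le_trans (hs 0) _; rewrite cbin0|exact: norm_sqrt_poly_le].
by rewrite -natrD.
Qed.

Lemma sqrt_one_sub_sqr : s * s = 1 - x.
Proof.
(* The constant is [4 * 2 + 2 * 2 + 1], from [|s| <= 4], [|q| <= 2], [|s - q| <= 2 cbin K] and
   [cbin K ^+ 2 <= cbin K]. The shift to [K0.+1] makes the degree positive. *)
apply/eqP; rewrite -subr_eq0 -normr_eq0; apply/eqP; apply: (@le_cbin_eq0 R _ 13) => // K0.
apply: (@le_trans _ _ (13 * cbin C K0.+1)); last first.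
  by rewrite ler_wpM2l ?cbin_le.
set K := K0.+1; set q := horner_alg x (sqrt_poly K).
have -> : s * s - (1 - x) = s * (s - q) + (s - q) * q + (q ^+ 2 - (1 - x)).
  by rewrite mulrBr mulrBl expr2 !addrA !subrK.
have -> : 13 * cbin C K = 4 * (cbin C K *+ 2) + (cbin C K *+ 2) * 2 + cbin C K.
  by ring.
apply: le_trans (ler_normD _ _) _; apply: lerD.
  apply: le_trans (ler_normD _ _) _; apply: lerD; apply: le_trans (normM_le _ _) _.
    by rewrite ler_pM ?sqrt_one_sub_norm ?hs.
  by rewrite ler_pM ?norm_sqrt_poly_le ?hs.
apply: le_trans (norm_sqrt_poly_err _ _) _ => //.
by rewrite expr2 ler_piMl ?cbin_le1 // ltW ?cbin_gt0.
Qed.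

Lemma sqrt_one_sub_comm y : GRing.comm y x -> GRing.comm y s.
Proof.
move=> yx; apply/eqP; rewrite -subr_eq0 -normr_eq0; apply/eqP.
apply: (@le_cbin_eq0 R _ (4 * `|y|)) => // K; set q := horner_alg x (sqrt_poly K).
have yq : y * q = q * y.
  rewrite /q horner_alg_sqrt_poly; apply: commr_sum => i _.
  by rewrite /GRing.comm -scalerAr -scalerAl commrX.
have -> : y * s - s * y = y * (s - q) - (s - q) * y.
  by rewrite mulrBr mulrBl yq opprB addrA subrK.
have -> : 4 * `|y| * cbin C K = `|y| * (cbin C K *+ 2) + (cbin C K *+ 2) * `|y|.
  by ring.
apply: le_trans (ler_normB _ _) _; apply: lerD; apply: le_trans (normM_le _ _) _.
  by rewrite ler_wpM2l ?hs.
by rewrite ler_wpM2r ?hs.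
Qed.

Lemma sqrt_one_sub_star : star x = x -> star s = s.
Proof.
move=> xx; apply/eqP; rewrite -subr_eq0 -normr_eq0; apply/eqP.
apply: (@le_cbin_eq0 R _ 4) => // K; set q := horner_alg x (sqrt_poly K).
have qq : star q = q.
  rewrite /q horner_alg_sqrt_poly star_sum; apply: eq_bigr => i _.
  rewrite starZ starX xx conj_Creal //.
  by case: (nat_of_ord i) => [|k]; rewrite ?sqrt_coef0 ?real1 // ler0_real ?sqrt_coefS_le0.
have -> : star s - s = star (s - q) - (s - q).
  by rewrite starD starN qq opprB addrA subrK.
have -> : 4 * cbin C K = cbin C K *+ 2 + cbin C K *+ 2 by ring.
by apply: le_trans (ler_normB _ _) _; rewrite norm_star lerD ?hs.
Qed.

End Sqrt.

Definition unitary (u : A) := star u * u = 1 /\ u * star u = 1.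

Lemma unitary_norm u : unitary u -> `|u| = 1.
Proof.
move=> [uu _]; have := norm_starM u; rewrite uu norm1 => /esym/eqP.
by rewrite sqrf_eq1 => /orP[/eqP //|/eqP h]; have := normr_ge0 u; rewrite h oppr_ge0 ler10.
Qed.

Lemma selfadjoint_unitary (b : A) : star b = b -> `|b| <= 1 ->
  exists2 u, unitary u & b = 2^-1 *: (u + star u).
Proof.
move=> bb b1; have x1 : `|b ^+ 2| <= 1 by apply: normX_le1.
have [s hs] := sqrt_one_sub_exists x1.
have ss : star s = s by apply: (sqrt_one_sub_star hs); rewrite starX bb.
have s2 := sqrt_one_sub_sqr x1 hs.
have bs : b * s = s * b by apply: (sqrt_one_sub_comm hs); exact: commrX.
pose t : A := 'i *: s.
have us : star (b + t) = b - t by rewrite starD starZ bb ss conjCi scaleNr.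
have bt : b * t = t * b by rewrite -scalerAr -scalerAl bs.
have tt : t * t = b * b - 1.
  by rewrite -scalerAr -scalerAl scalerA -['i * 'i]expr2 sqrCi scaleN1r s2 opprB expr2.
exists (b + t).
  split; rewrite us.
    by rewrite mulrBl !mulrDr bt tt opprD addrA addrK opprB addrC subrK.
  by rewrite mulrBr !mulrDl bt tt opprD addrA addrK opprB addrC subrK.
rewrite us addrACA subrr addr0 -mulr2n -(scaler_nat 2 b) scalerA mulVf ?scale1r //.
Qed.

End CstarAlgebra.

(** * Fourier averages *)

Lemma prim_root_neq0 (F : fieldType) (N : nat) (z : F) : N.-primitive_root z -> z != 0.
Proof.
move=> zN; apply/eqP => z0; have := prim_expr_order zN.
by rewrite z0 expr0n (gtn_eqF (prim_order_gt0 zN)) => /eqP; rewrite eq_sym oner_eq0.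
Qed.

(** Orthogonality of characters: for [i != k] this is a geometric sum whose ratio is an [N]-th root
    of unity other than 1. *)
Lemma sum_prim_root_exp (F : fieldType) (N : nat) (z : F) i k :
  N.-primitive_root z -> (i < N)%N -> (k < N)%N ->
  \sum_(j < N) (z ^+ j) ^+ i / (z ^+ j) ^+ k = (i == k)%:R * N%:R.
Proof.
move=> zN iN kN; set y := z ^+ i / z ^+ k.
have z0 := prim_root_neq0 zN.
have -> : \sum_(j < N) (z ^+ j) ^+ i / (z ^+ j) ^+ k = \sum_(j < N) y ^+ j.
  by apply: eq_bigr => j _; rewrite expr_div_n -!exprM ![(_ * j)%N]mulnC.
have [ik|ik] := eqVneq i k.
  rewrite mul1r (eq_bigr (fun=> 1)) ?sumr_const ?card_ord // => j _.
  by rewrite /y ik divff ?expf_neq0 // expr1n.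
have y1 : y - 1 != 0.
  rewrite subr_eq0 /y; apply: contra ik => /eqP h.
  have : z ^+ i == z ^+ k by rewrite -[z ^+ i](divfK (expf_neq0 k z0)) h mul1r.
  by rewrite (eq_prim_root_expr zN) !modn_small.
rewrite mul0r; apply: (mulfI y1); rewrite mulr0 -subrX1 /y expr_div_n.
by rewrite -!exprM !(mulnC _ N) !exprM (prim_expr_order zN) !expr1n divr1 subrr.
Qed.

Section Fourier.
Variables (F : numFieldType) (A : algType F) (g h : A).
Hypotheses (gh : g * h = 1) (hg : h * g = 1).

(* For [g = u^2], [h = u^-2] and [m = z^2] with [u] unitary and [|z| = 1] this is
   [Im (z u) ^+ 2]. *)
Definition sin_sqr (m : F) : A := 4^-1 *: (2 - m *: g - m^-1 *: h).

Lemma exp_inverse_pair i : g ^+ i * h ^+ i = 1.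
Proof.
elim: i => [|i IHi]; first by rewrite mulr1.
by rewrite exprSr exprS mulrA -(mulrA _ g) gh mulr1.
Qed.

(** Completing the square gives [sin_sqr m = - (1 - m g)^2 h / (4 m)]; the factors commute, so the
    binomial theorem with exponent [2k] applies. *)
Lemma sin_sqrX (m : F) k : m != 0 -> sin_sqr m ^+ k =
  \sum_(i < (k.*2).+1) ((- 4^-1) ^+ k * (-1) ^+ i * 'C(k.*2, i)%:R * (m ^+ i / m ^+ k))
     *: (g ^+ i * h ^+ k).
Proof.
move=> m0.
have xE : sin_sqr m = (- 4^-1 / m) *: ((1 - m *: g) ^+ 2 * h).
  have -> : (1 - m *: g) ^+ 2 * h = h + (- (2 * m)) *: 1 + m ^+ 2 *: g.
    rewrite expr2 -mulrA [(1 - _) * h]mulrBl mul1r -scalerAl gh mulrBl mul1r.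
    rewrite mulrBr -scalerAl gh -scalerAr mulr1 scalerA -expr2 opprB.
    by rewrite addrACA scaleNr mulr_natl mulr2n scalerDl opprD -!addrA [X in h + X]addrC !addrA.
  rewrite /sin_sqr -[2 in LHS](scaler_nat 2 (1 : A)) !scalerDr !scalerN !scalerA.
  rewrite -(scaleNr _ g) -(scaleNr _ h) -[RHS]addrA [RHS]addrC.
  by congr (_ *: _ + _ *: _ + _ *: _); field.
have c1 : GRing.comm (1 - m *: g) h.
  by rewrite /GRing.comm mulrBl mulrBr mul1r mulr1 -scalerAl -scalerAr gh hg.
rewrite xE (exprZn (- 4^-1 / m) ((1 - m *: g) ^+ 2 * h)).
rewrite [X in _ *: X]exprMn_comm; last exact: commr_sym (commrX _ (commr_sym c1)).
rewrite -exprM mul2n exprBn_comm; last exact: commr_sym (commr1 _).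
rewrite mulr_suml scaler_sumr; apply: eq_bigr => i _.
have -> : (-1) ^+ i = ((-1) ^+ i)%:A :> A by rewrite -in_algE rmorph_sign.
rewrite expr1n mulr1 mulr_algl (exprZn m g).
rewrite -(scaler_nat 'C(_, i) ((-1) ^+ i *: (m ^+ i *: g ^+ i) : A)).
rewrite -!scalerAl !scalerA; congr (_ *: _).
rewrite expr_div_n -[_ *: m ^- k]/(_ * m ^- k).
by field; rewrite expf_neq0.
Qed.

Variables (N : nat) (z : F).
Hypothesis zN : N.-primitive_root z.

(** Orthogonality keeps only [i = k + e], where [g^i h^k = g^e]. The roots enter squared, so the
    exponents compared are [2i <= 4k] and [2(k+e) <= 4k+2]; both must stay below [N]. *)
Lemma avg_sin_sqrX k e : (k.*2.*2.+2 < N)%N -> (e <= 1)%N ->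
  \sum_(j < N) ((z ^+ j) ^+ 2) ^- e *: sin_sqr ((z ^+ j) ^+ 2) ^+ k =
  (N%:R * ((-1) ^+ e * 'C(k.*2, k + e)%:R / 4 ^+ k)) *: g ^+ e.
Proof.
move=> kN e1.
pose c i : F := (- 4^-1) ^+ k * (-1) ^+ i * 'C(k.*2, i)%:R.
transitivity (\sum_(i < (k.*2).+1)
    (c i * ((i == k + e :> nat)%:R * N%:R)) *: (g ^+ i * h ^+ k)).
  under eq_bigr => j _ do rewrite sin_sqrX ?expf_neq0 ?(prim_root_neq0 zN) // scaler_sumr.
  rewrite exchange_big /=; apply: eq_bigr => i _.
  under eq_bigr => j _ do rewrite scalerA.
  rewrite -scaler_suml; congr (_ *: _).
  have -> : (i == k + e :> nat) = (i.*2 == (k + e).*2 :> nat) by lia.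
  have iK := ltn_ord i.
  rewrite -(sum_prim_root_exp zN); [|lia|lia].
  rewrite mulr_sumr; apply: eq_bigr => j _.
  rewrite /c -!exprM -(mul2n i) -(mul2n (k + e)) (mulnDr 2 k e).
  rewrite (mulnDr j (2 * k) (2 * e)) (exprD z (j * (2 * k)) (j * (2 * e))) invfM.
  by rewrite [LHS]mulrC -!mulrA.
rewrite (bigID (fun i : 'I__ => i == k + e :> nat)) /= [X in _ + X]big1 ?addr0; last first.
  by move=> i /negbTE ->; rewrite mul0r mulr0 scale0r.
rewrite (eq_bigr (fun i : 'I__ =>
    (fun=> (c (k + e)%N * N%:R) *: g ^+ e) (nat_of_ord i))); last first.
  move=> i /eqP ->.
  by rewrite eqxx mul1r [X in g ^+ X]addnC exprD -mulrA exp_inverse_pair mulr1.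
rewrite (big_ord1_eq _ (fun=> (c (k + e)%N * N%:R) *: g ^+ e)).
have cE : c (k + e)%N = (-1) ^+ e * 'C(k.*2, k + e)%:R / 4 ^+ k.
  rewrite /c exprD -[- 4^-1]mulN1r exprMn exprVn.
  have -> : (-1) ^+ k / 4 ^+ k * ((-1) ^+ k * (-1) ^+ e) =
     ((-1) ^+ k * (-1) ^+ k) * (-1) ^+ e / 4 ^+ k :> F by ring.
  by rewrite -expr2 sqrr_sign; ring.
(* The index [k + e] is out of range only for [k = 0], [e = 1], and then the binomial coefficient is
   0. *)
case: ifP => ke; first by rewrite cE mulrC.
by rewrite bin_small ?mulr0 ?mul0r ?mulr0 ?scale0r //; lia.
Qed.

End Fourier.

(** * Forms vanishing on zero products *)

Section ZeroProduct.
Variables (R : realType) (A0 : completeNormedModType (complex R)).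
Variables (mul : A0 -> A0 -> A0) (one : A0) (involA : A0 -> A0).
Variables (hA : unital_cstar_algebra mul one involA) (h1 : one != 0).
Local Notation C := (complex R).
Local Notation A := (cstar_type hA h1).
Variable B : normedModType C.

Record zero_product_form (M : C) (T : A -> A -> B) : Prop := {
  zp_Dl : forall x y z, T (x + y) z = T x z + T y z;
  zp_Dr : forall x y z, T x (y + z) = T x y + T x z;
  zp_Zl : forall c x y, T (c *: x) y = c *: T x y;
  zp_Zr : forall c x y, T x (c *: y) = c *: T x y;
  zp_norm : forall x y, `|T x y| <= M * `|x| * `|y|;
  zp_eq0 : forall x y, x * y = 0 -> T x y = 0
}.

Section Form.
Variables (M : C) (T : A -> A -> B).
Hypothesis hT : zero_product_form M T.

Lemma zp_Nl x y : T (- x) y = - T x y.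
Proof. by rewrite -scaleN1r (zp_Zl hT) scaleN1r. Qed.
Lemma zp_Nr x y : T x (- y) = - T x y.
Proof. by rewrite -scaleN1r (zp_Zr hT) scaleN1r. Qed.
Lemma zp_Bl x y z : T (x - y) z = T x z - T y z.
Proof. by rewrite (zp_Dl hT) zp_Nl. Qed.
Lemma zp_Br x y z : T x (y - z) = T x y - T x z.
Proof. by rewrite (zp_Dr hT) zp_Nr. Qed.
Lemma zp_0l y : T 0 y = 0.
Proof. by rewrite -(scale0r 0) (zp_Zl hT) scale0r. Qed.
Lemma zp_0r y : T y 0 = 0.
Proof. by rewrite -(scale0r 0) (zp_Zr hT) scale0r. Qed.
Lemma zp_suml I (r : seq I) F y : T (\sum_(i <- r) F i) y = \sum_(i <- r) T (F i) y.
Proof. by apply: (big_morph (T^~ y)) => [a b|]; rewrite ?(zp_Dl hT) ?zp_0l. Qed.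
Lemma zp_sumr I (r : seq I) F y : T y (\sum_(i <- r) F i) = \sum_(i <- r) T y (F i).
Proof. by apply: (big_morph (T y)) => [a b|]; rewrite ?(zp_Dr hT) ?zp_0r. Qed.

Lemma zp_M_ge0 : 0 <= M.
Proof. by have := zp_norm hT 1 1; rewrite norm1 !mulr1; exact: le_trans. Qed.

(** If [x y = 0] then [a x y c = 0]. Identities at [u] and 1 can thus be moved along powers of [u],
    or multiplied by an arbitrary element. *)
Lemma zp_translate (a c : A) :
  zero_product_form (M * `|a| * `|c|) (fun x y => T (a * x) (y * c)).
Proof.
split=> [x y z|x y z|k x y|k x y|x y|x y xy].
- by rewrite mulrDr (zp_Dl hT).
- by rewrite mulrDl (zp_Dr hT).
- by rewrite -scalerAr (zp_Zl hT).
- by rewrite -scalerAl (zp_Zr hT).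
- apply: le_trans (zp_norm hT _ _) _.
  have -> : M * `|a| * `|c| * `|x| * `|y| = M * (`|a| * `|x|) * (`|y| * `|c|) by ring.
  by rewrite ler_pM ?normM_le ?mulr_ge0 ?zp_M_ge0 // ler_wpM2l ?zp_M_ge0 ?normM_le.
- by apply: (zp_eq0 hT); rewrite mulrA -(mulrA a) xy mulr0 mul0r.
Qed.

Lemma sin_sqr_norm (v : A) : unitary v -> `|4^-1 *: (2 - v ^+ 2 - star v ^+ 2)| <= 1.
Proof.
move=> uv; have v1 : `|v| <= 1 by rewrite unitary_norm.
have sv1 : `|star v| <= 1 by rewrite norm_star.
rewrite normrZ ger0_norm ?invr_ge0 ?ler0n // ler_pdivrMl ?ltr0n // mulr1.
have -> : (4 : C) = 1 + 1 + 1 + 1 by ring.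
apply: le_trans (ler_normB _ _) _; apply: lerD; last exact: normX_le1.
apply: le_trans (ler_normB _ _) _; apply: lerD; last exact: normX_le1.
by apply: le_trans (ler_normD _ _) _; rewrite norm1.
Qed.

(* With [s = |Re v|], the elements [s + Re v] and [s - Re v] have product
   zero in both orders. *)
Lemma zp_abs_swap (v s : A) : unitary v ->
  (forall K,
     `|s - horner_alg (4^-1 *: (2 - v ^+ 2 - star v ^+ 2)) (sqrt_poly R K)|
       <= cbin C K *+ 2) ->
  T (v + star v) s = T s (v + star v).
Proof.
move=> uv hs; have [vv vv'] := uv; have x1 := sin_sqr_norm uv.
set x := 4^-1 *: _ in hs x1; set w := v + star v.
have w2 : w * w = 2 + v ^+ 2 + star v ^+ 2.
  rewrite /w mulrDr !mulrDl vv vv' -!expr2.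
  by rewrite [v ^+ 2 + 1]addrC addrACA addrA.
have xE : x = 1 - 4^-1 *: (w * w).
  have -> : 1 = 4^-1 *: 4 :> A.
    by rewrite -(scaler_nat 4 (1 : A)) scalerA mulVf ?scale1r // pnatr_eq0.
  rewrite -scalerBr w2 /x; congr (_ *: _).
  by rewrite -[2 + v ^+ 2 + _]addrA [in RHS]opprD addrA -(natrB A (isT : 2 <= 4)%N) opprD addrA.
(* As [w] is twice the real part of [v], the root is doubled to match [w] in square. *)
have s2 : (2 *: s) * (2 *: s) = w * w.
  rewrite -scalerAl -scalerAr scalerA (sqrt_one_sub_sqr x1 hs) xE opprB addrCA subrr addr0.
  by rewrite scalerA -natrM mulfV ?scale1r // pnatr_eq0.
have ws : w * (2 *: s) = (2 *: s) * w.
  rewrite -scalerAl -scalerAr; congr (_ *: _); apply: (sqrt_one_sub_comm hs).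
  by rewrite -/x xE /GRing.comm mulrBl mulrBr mulr1 mul1r -scalerAl -scalerAr mulrA.
set s' := 2 *: s in s2 ws.
clear xE w2; clearbody w.
have e1 : T (s' + w) (s' - w) = 0.
  by apply: (zp_eq0 hT); rewrite mulrDl !mulrBr ws s2 addrA subrK subrr.
have e2 : T (s' - w) (s' + w) = 0.
  by apply: (zp_eq0 hT); rewrite mulrBl !mulrDr ws s2 opprD addrA addrK subrr.
have a1 : T s' s' + T w s' = T s' w + T w w.
  by apply/eqP; rewrite -subr_eq0 opprD addrACA -!zp_Br -(zp_Dl hT) e1.
have a2 : T w s' + T w w = T s' s' + T s' w.
  by apply/esym/eqP; rewrite -subr_eq0 -!(zp_Dr hT) -zp_Bl e2.
(* Adding the two expansions cancels [T s' s'] and [T w w], leaving twice the claim. *)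
have : T w s' + T w s' = T s' w + T s' w.
  apply: (@addrI _ (T s' s' + T w w)).
  rewrite addrACA a1 [T w w + _]addrC a2 addrACA [T s' w + T s' s']addrC.
  by rewrite addrACA.
rewrite -!mulr2n -(scaler_nat 2 (T w s')) -(scaler_nat 2 (T s' w)) /s'.
rewrite (zp_Zl hT) (zp_Zr hT) !scalerA => /scalerI; apply.
by rewrite -natrM pnatr_eq0.
Qed.


(** Replaces the exact root by a polynomial, whose Fourier averages are finite sums. Each of the two
    error terms is at most [M * 2 * 2 cbin K]. *)
Lemma zp_sqrt_poly_swap (v q : A) K : unitary v ->
  q = horner_alg (4^-1 *: (2 - v ^+ 2 - star v ^+ 2)) (sqrt_poly R K) ->
  `|T (v + star v) q - T q (v + star v)| <= 8 * M * cbin C K.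
Proof.
move=> uv qE; have [s hs] := sqrt_one_sub_exists (sin_sqr_norm uv).
set w := v + star v; have Tws : T w s = T s w := zp_abs_swap uv hs.
have -> : T w q - T q w = T (s - q) w - T w (s - q).
  by rewrite zp_Br zp_Bl Tws opprB [RHS]addrC -addrA [T w q + _]addrC addrA addrA subrK addrC.
have w2 : `|w| <= 2.
  by apply: le_trans (ler_normD _ _) _; rewrite norm_star (unitary_norm uv).
have sq := hs K; rewrite -qE in sq.
have M0 := zp_M_ge0; have b0 := ltW (cbin_gt0 C K).
apply: le_trans (ler_normB _ _) _.
have -> : 8 * M * cbin C K = M * (cbin C K *+ 2) * 2 + M * 2 * (cbin C K *+ 2) by ring.
apply: lerD; apply: le_trans (zp_norm hT _ _) _.
  by rewrite ler_pM ?mulr_ge0 // ler_wpM2l.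
by rewrite ler_pM ?mulr_ge0 // ler_wpM2l.
Qed.

Lemma unitary_scale (u : A) (z : C) : unitary u -> `|z| = 1 -> unitary (z *: u).
Proof.
move=> [u1 u2] z1.
have zz : z^* * z = 1 by rewrite mulrC -normCK z1 expr1n.
by split; rewrite starZ -scalerAl -scalerAr scalerA ?u1 ?u2 1?[z * _]mulrC zz scale1r.
Qed.

(** * Averaging the swap identity over roots of unity *)

Section Average.
Variables (u : A) (K : nat).
Hypothesis uu : unitary u.

Lemma unitary_sqr_inv : u ^+ 2 * star u ^+ 2 = 1.
Proof. by case: uu => _ h; rewrite !expr2 mulrA -(mulrA u u) h mulr1 h. Qed.

Lemma unitary_inv_sqr : star u ^+ 2 * u ^+ 2 = 1.
Proof. by case: uu => h _; rewrite !expr2 mulrA -(mulrA (star u) (star u)) h mulr1 h. Qed.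

Variables (N : nat) (z : C).
Hypotheses (zN : N.-primitive_root z) (KN : (K.*2.*2.+2 < N)%N).

Lemma prim_root_norm : `|z| = 1.
Proof.
have := congr1 Num.norm (prim_expr_order zN); rewrite normrX normr1 => h.
by apply/eqP; rewrite -(@pexpr_eq1 _ _ N) ?h // (prim_order_gt0 zN).
Qed.

Let q j := horner_alg (sin_sqr (u ^+ 2) (star u ^+ 2) ((z ^+ j) ^+ 2)) (sqrt_poly R K).

Lemma avg_sqrt_poly0 : \sum_(j < N) q j = (N%:R * fourier0 C K) *: 1.
Proof.
rewrite /q; under eq_bigr => j _ do rewrite horner_alg_sqrt_poly.
rewrite exchange_big /= mulr_sumr scaler_suml; apply: eq_bigr => k _.
have kK := ltn_ord k.
have avg : \sum_(j < N) sin_sqr (u ^+ 2) (star u ^+ 2) ((z ^+ j) ^+ 2) ^+ k =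
    (N%:R * cbin C k) *: 1.
  have := @avg_sin_sqrX C A _ _ unitary_sqr_inv unitary_inv_sqr N z zN k 0.
  rewrite addn0 !expr0 mul1r => <- //; last by lia.
  by apply: eq_bigr => j _; rewrite expr0 invr1 scale1r.
by rewrite -scaler_sumr avg scalerA; congr (_ *: _); ring.
Qed.

Lemma avg_sqrt_poly2 :
  \sum_(j < N) ((z ^+ j) ^+ 2)^-1 *: q j = (N%:R * fourier2 C K) *: u ^+ 2.
Proof.
rewrite /q; under eq_bigr => j _ do rewrite horner_alg_sqrt_poly scaler_sumr.
rewrite exchange_big /= /fourier2 -sumrN mulr_sumr scaler_suml; apply: eq_bigr => k _.
have kK := ltn_ord k.
(* Rewrites the order 2 coefficient in the form used in [fourier2]. *)
have binE : 'C(k.*2, k + 1)%:R = 'C(k.*2, k)%:R * k%:R / k.+1%:R :> C.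
  apply: (canRL (mulfK _)); first by rewrite pnatr_eq0.
  by rewrite -!natrM addn1 mulnC mul_bin_left -addnn addnK mulnC.
have avg : \sum_(j < N) ((z ^+ j) ^+ 2)^-1 *:
    sin_sqr (u ^+ 2) (star u ^+ 2) ((z ^+ j) ^+ 2) ^+ k =
    (N%:R * - (cbin C k * k%:R / k.+1%:R)) *: u ^+ 2.
  have := @avg_sin_sqrX C A _ _ unitary_sqr_inv unitary_inv_sqr N z zN k 1.
  rewrite binE [(u ^+ 2) ^+ 1]expr1 expr1 => h.
  rewrite [RHS](_ : _ = (N%:R * (-1 * ('C(k.*2, k)%:R * k%:R / k.+1%:R) / 4 ^+ k)) *: u ^+ 2).
    by rewrite -h //; lia.
  by congr (_ *: _); rewrite /cbin; ring.
rewrite -[LHS]/(\sum_(j < N) _).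
under eq_bigr => j _ do rewrite scalerA mulrC -scalerA.
by rewrite -scaler_sumr avg scalerA; congr (_ *: _); ring.
Qed.

Lemma zp_fourier_bound :
  `|fourier0 C K *: (T u 1 - T 1 u) +
    fourier2 C K *: (T (star u) (u ^+ 2) - T (u ^+ 2) (star u))| <= 8 * M * cbin C K.
Proof.
have N0 : (0 : C) < N%:R by rewrite ltr0n (prim_order_gt0 zN).
have zn j : `|z ^+ j| = 1 by rewrite normrX prim_root_norm expr1n.
have z0 j : z ^+ j != 0 by rewrite -normr_eq0 zn oner_eq0.
have zc j : (z ^+ j)^* = (z ^+ j)^-1.
  by apply: (mulIf (z0 j)); rewrite mulVf // mulrC -normCK zn expr1n.
pose v j := z ^+ j *: u.
have sv j : star (v j) = (z ^+ j)^-1 *: star u by rewrite starZ zc.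
pose E j := T (v j + star (v j)) (q j) - T (q j) (v j + star (v j)).
have hE j : `|E j| <= 8 * M * cbin C K.
  apply: zp_sqrt_poly_swap; first exact: unitary_scale.
  by rewrite /q /sin_sqr sv /v !exprZn exprVn.
(* The weight [z^-j] removes the phase of [u] and leaves [z^(-2j)] on [star u], so averages of
   orders 0 and 2 appear. *)
have EE j : (z ^+ j)^-1 *: E j =
    (T u (q j) - T (q j) u) +
    (T (star u) (((z ^+ j) ^+ 2)^-1 *: q j) - T (((z ^+ j) ^+ 2)^-1 *: q j) (star u)).
  rewrite /E sv /v !(zp_Dl hT) !(zp_Dr hT) !(zp_Zl hT) !(zp_Zr hT).
  rewrite scalerBr !scalerDr !scalerA mulVf // !scale1r -expr2 exprVn.
  by rewrite opprD addrACA.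
have sE : \sum_(j < N) (z ^+ j)^-1 *: E j = N%:R *: (fourier0 C K *: (T u 1 - T 1 u) +
    fourier2 C K *: (T (star u) (u ^+ 2) - T (u ^+ 2) (star u))).
  under eq_bigr => j _ do rewrite EE.
  rewrite big_split /= !sumrB -!zp_sumr -!zp_suml avg_sqrt_poly0 avg_sqrt_poly2.
  by rewrite !(zp_Zl hT) !(zp_Zr hT) -!scalerBr -!scalerA -scalerDr.
rewrite -(ler_pM2l N0) -[X in X * _ <= _](gtr0_norm N0) -normrZ -sE.
apply: le_trans (ler_norm_sum _ _ _) _.
apply: (@le_trans _ _ (\sum_(j < N) 8 * M * cbin C K)).
  by apply: ler_sum => j _; rewrite normrZ normfV zn invr1 mul1r.
by rewrite sumr_const card_ord (mulr_natl _ N).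
Qed.

End Average.

Lemma zp_third_difference (u : A) : unitary u ->
  3 *: (T u 1 - T 1 u) + (T (star u) (u ^+ 2) - T (u ^+ 2) (star u)) = 0.
Proof.
move=> uu; set D := T u 1 - T 1 u; set E := T (star u) _ - _.
have M0 := zp_M_ge0.
(* Here [96 = 8 * 12]: 8 comes from [fourier2_ge], and [12 = 8 + 2 * 2] adds to the bound of
   [zp_fourier_bound] the cost [r * |D|] of replacing [fourier0] by [3 * fourier2]. *)
apply/eqP; rewrite -normr_eq0; apply/eqP; apply: (@le_cbin_eq0 R _ (96 * M)) => // K0.
apply: (@le_trans _ _ (96 * M * cbin C K0.+1)); last first.
  by rewrite ler_wpM2l ?cbin_le ?mulr_ge0.
set K := K0.+1; have b0 := ltW (cbin_gt0 C K).
have [z zN] := prim_root_exp2_exists R K.*2.*2.+2.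
have KN : (K.*2.*2.+2 < 2 ^ K.*2.*2.+2.+1)%N.
  by apply: ltn_trans (ltnSn _) _; exact: ltn_expl.
have h := zp_fourier_bound uu zN KN; rewrite -/D -/E in h.
set r := K.*2.+1%:R / K.+1%:R * cbin C K ^+ 2.
have f0 : fourier0 C K = 3 * fourier2 C K + r by rewrite /r -fourier_relation addrC subrK.
have r0 : 0 <= r by rewrite !mulr_ge0 ?invr_ge0 ?ler0n ?exprn_ge0.
have r2 : r <= 2 * cbin C K.
  apply: ler_pM; rewrite ?divr_ge0 ?ler0n ?exprn_ge0 //.
    by rewrite ler_pdivrMr ?ltr0n // -natrM ler_nat; lia.
  by rewrite expr2 ler_piMl ?cbin_le1.
have D2 : `|D| <= 2 * M.
  have t1 := zp_norm hT u 1; have t2 := zp_norm hT 1 u.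
  rewrite norm1 (unitary_norm uu) !mulr1 in t1 t2.
  by rewrite mulr_natl mulr2n; apply: le_trans (ler_normB _ _) (lerD t1 t2).
have f2 : 0 <= fourier2 C K.
  by apply: le_trans _ (fourier2_ge C (ltn0Sn K0)); rewrite invr_ge0 ler0n.
have fE : `|fourier2 C K *: (3 *: D + E)| <= 12 * M * cbin C K.
  have -> : fourier2 C K *: (3 *: D + E) =
     fourier0 C K *: D + fourier2 C K *: E - r *: D.
    by rewrite f0 scalerDr scalerA [_ * 3]mulrC scalerDl addrAC addrK.
  apply: le_trans (ler_normB _ _) _.
  have -> : 12 * M * cbin C K = 8 * M * cbin C K + (2 * cbin C K) * (2 * M) by ring.
  by apply: lerD => //; rewrite normrZ ger0_norm // ler_pM.
rewrite normrZ ger0_norm // in fE.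
rewrite -(@ler_pM2l _ 8^-1) ?invr_gt0 ?ltr0n //.
apply: le_trans (ler_wpM2r (normr_ge0 _) (fourier2_ge C (ltn0Sn K0))) _.
by apply: le_trans fE _; rewrite le_eqVlt; apply/orP; left; apply/eqP; field.
Qed.

End Form.

Lemma zp_unitary_swap M T (u : A) : zero_product_form M T -> unitary u -> T u 1 = T 1 u.
Proof.
move=> hT uu; have [u1 u2] := uu.
pose f k := T (u ^+ k) (star u ^+ k * u).
have n1 := unitary_norm uu.
have M0 := zp_M_ge0 hT.
have hf k : `|f k| <= M.
  apply: le_trans (zp_norm hT _ _) _; rewrite -mulrA ler_piMr // mulr_ile1 //.
    by rewrite normX_le1 ?n1.
  by apply: le_trans (normM_le _ _) _; rewrite n1 mulr1 normX_le1 // norm_star n1.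
have d3 k : 3 *: (f k.+2 - f k.+1) + (f k - f k.+3) = 0.
  (* With these translations the four terms become [f] at [k+2], [k+1], [k] and [k+3]. *)
  have := zp_third_difference (zp_translate hT (u ^+ k.+1) (star u ^+ k.+2 * u)) uu.
  have e1 : u * star u ^+ k.+2 = star u ^+ k.+1 by rewrite exprS mulrA u2 mul1r.
  have e2 : u * star u ^+ k.+1 = star u ^+ k by rewrite exprS mulrA u2 mul1r.
  have g1 : u ^+ k.+1 * u = u ^+ k.+2 by rewrite -exprSr.
  have g2 : u * (star u ^+ k.+2 * u) = star u ^+ k.+1 * u by rewrite mulrA e1.
  have g3 : u ^+ k.+1 * star u = u ^+ k by rewrite exprSr -mulrA u2 mulr1.
  have g4 : u ^+ 2 * (star u ^+ k.+2 * u) = star u ^+ k * u.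
    by rewrite expr2 -mulrA g2 mulrA e2.
  have g5 : u ^+ k.+1 * u ^+ 2 = u ^+ k.+3 by rewrite -exprD addn2.
  have g6 : star u * (star u ^+ k.+2 * u) = star u ^+ k.+3 * u by rewrite mulrA -exprS.
  by rewrite [u ^+ k.+1 * 1]mulr1 [1 * _]mul1r g1 g2 g3 g4 g5 g6.
have diff3 k : (f k.+3 - f k.+2) - (f k.+2 - f k.+1) = (f k.+2 - f k.+1) - (f k.+1 - f k).
  apply/eqP; rewrite eq_sym -subr_eq0 -(d3 k); apply/eqP.
  rewrite scaler_nat mulrS mulr2n; move: (f k) (f k.+1) (f k.+2) (f k.+3) => a b c d.
  rewrite [in LHS]opprB [- (_ - _ - _)]opprB [- (d - c)]opprB addrACA [RHS]addrC.
  rewrite [in RHS]addrC [c - b + (c - b + _)]addrC -[RHS]addrA; congr (_ + _).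
  by rewrite addrACA [RHS]addrACA [a + c]addrC.
(* The endpoints are [f 1 = T u 1] and [f 0 = T 1 u]. *)
have h01 : f 1%N = f 0%N := bounded_diff3_const hf diff3 0.
by move: h01; rewrite /f !expr0 !expr1 u1 mul1r.
Qed.

Lemma zp_swap M T (b : A) : zero_product_form M T -> T b 1 = T 1 b.
Proof.
move=> hT.
have swapZ c x : T x 1 = T 1 x -> T (c *: x) 1 = T 1 (c *: x).
  by rewrite (zp_Zl hT) (zp_Zr hT) => ->.
have swapD x y : T x 1 = T 1 x -> T y 1 = T 1 y -> T (x + y) 1 = T 1 (x + y).
  by rewrite (zp_Dl hT) (zp_Dr hT) => -> ->.
have swap_unitary x : unitary x -> T x 1 = T 1 x by exact: zp_unitary_swap hT.
have unitary_star x : unitary x -> unitary (star x) by case=> ? ?; split; rewrite starK.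
have swap_sa x : star x = x -> T x 1 = T 1 x.
  move=> xx; have [->|x0] := eqVneq x 0; first by rewrite (zp_0l hT) (zp_0r hT).
  have n0 : `|x| != 0 by rewrite normr_eq0.
  rewrite -[x](scale1r x) -(mulfV n0) -scalerA; apply: (swapZ).
  have [| |u uu ->] := @selfadjoint_unitary _ _ _ _ _ hA h1 (`|x|^-1 *: x).
  - by rewrite starZ xx conj_Creal // rpredV normr_real.
  - by rewrite normrZ normfV normr_id mulVf.
  by apply: (swapZ); apply: (swapD); apply: (swap_unitary) => //; exact: unitary_star.
(* Cartesian decomposition: [c] is selfadjoint and [- 'i *: c = b - star b]. *)
pose c : A := 'i *: (b - star b).
have bE : b = 2^-1 *: ((b + star b) + (- 'i) *: c).
  rewrite /c scalerA mulNr -['i * 'i]expr2 sqrCi opprK scale1r addrACA subrr addr0.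
  by rewrite -mulr2n -(scaler_nat 2 b) scalerA mulVf ?scale1r.
rewrite bE; apply: (swapZ); apply: (swapD); last apply: (swapZ); apply: (swap_sa).
  by rewrite starD starK addrC.
by rewrite starZ conjCi starD starN starK scaleNr -scalerN opprB.
Qed.

End ZeroProduct.

(** * From zero-product forms to the homomorphism *)

Lemma zero_product_balanced (R : realType)
    (A : completeNormedModType (complex R)) (mulA : A -> A -> A) (oneA : A)
    (starA : A -> A)
    (B : completeNormedModType (complex R)) (mulB : B -> B -> B) (oneB : B)
    (starB : B -> B)
    (hA : unital_cstar_algebra mulA oneA starA)
    (hB : unital_cstar_algebra mulB oneB starB)
    (phi psi : A -> B)
    (hphi : bounded_linear phi) (hpsi : bounded_linear psi)
    (hzp : forall a b : A, mulA a b = 0 -> mulB (phi a) (psi b) = 0) (a b : A) :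
  oneA != 0 -> mulB (phi (mulA a b)) (psi oneA) = mulB (phi a) (psi b).
Proof.
move=> h1; case: hphi => lphi [M1 hM1]; case: hpsi => lpsi [M2 hM2].
have addE (f : A -> B) : clinear f -> forall x y, f (x + y) = f x + f y.
  by move=> lf x y; have := lf 1 x y; rewrite !scale1r.
have scaleE (f : A -> B) : clinear f -> forall c x, f (c *: x) = c *: f x.
  move=> lf c x; have f0 : f 0 = 0 by apply: (@addrI _ (f 0)); rewrite -(addE f lf) !addr0.
  by have := lf c x 0; rewrite f0 !addr0.
have hT : @zero_product_form _ _ _ _ _ hA h1 B (M1%:C%C * M2%:C%C)
    (fun x y => mulB (phi x) (psi y)).
  split=> [x y z|x y z|c x y|c x y|x y|x y].
  - by rewrite (addE phi) // (cs_mulDl hB).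
  - by rewrite (addE psi) // (cs_mulDr hB).
  - by rewrite (scaleE phi) // (cs_mulZl hB).
  - by rewrite (scaleE psi) // (cs_mulZr hB).
  - apply: le_trans (cs_norm_mul hB _ _) _.
    have -> : M1%:C%C * M2%:C%C * `|x| * `|y| = (M1%:C%C * `|x|) * (M2%:C%C * `|y|) by ring.
    by apply: ler_pM.
  - exact: hzp.
pose a' : cstar_type hA h1 := a; pose b' : cstar_type hA h1 := b.
(* The form [T (a x) y] swapped at [b] reads [T (a b) 1 = T a b]. *)
by have := zp_swap b' (zp_translate hT a' 1); rewrite !mulr1.
Qed.

Theorem mainTheorem15 (R : realType)
    (A : completeNormedModType (complex R)) (mulA : A -> A -> A) (oneA : A)
    (starA : A -> A)
    (B : completeNormedModType (complex R)) (mulB : B -> B -> B) (oneB : B)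
    (starB : B -> B)
    (hA : unital_cstar_algebra mulA oneA starA)
    (hB : unital_cstar_algebra mulB oneB starB)
    (hBfin : finite_alg mulB oneB)
    (phi psi : A -> B)
    (hphi : bounded_linear phi) (hpsi : bounded_linear psi)
    (hzp : forall a b : A, mulA a b = 0 -> mulB (phi a) (psi b) = 0)
    (hphiinv : exists a : A, invertible mulB oneB (phi a))
    (hpsiinv : exists a : A, invertible mulB oneB (psi a)) :
  exists rho : A -> B, alg_hom mulA mulB rho /\
    (forall a : A, phi a = mulB (phi oneA) (rho a)) /\
    (forall a : A, psi a = mulB (rho a) (psi oneA)).
Proof.
have key a b : mulB (phi (mulA a b)) (psi oneA) = mulB (phi a) (psi b).
  (* If the unit is 0, all elements of [A] coincide and the identity is trivial. *)
  have [oneA0|] := eqVneq oneA 0; last exact: (zero_product_balanced hA hB hphi hpsi hzp).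
  have A0 x y : x = y :> A.
    suff z t : t = 0 :> A by rewrite (z x) (z y).
    rewrite -(cs_mul1l hA t) oneA0.
    by have := cs_mulZl hA 0 0 t; rewrite !scale0r.
  by rewrite (A0 (mulA a b) a) (A0 oneA b).
have mA := cs_mulA hB; have m1l := cs_mul1l hB; have m1r := cs_mul1r hB.
have [a0 [a0' [a0r a0l]]] := hphiinv; have [b0 [b0' [b0r b0l]]] := hpsiinv.
have key1 b : mulB (phi b) (psi oneA) = mulB (phi oneA) (psi b).
  by rewrite -{1}(cs_mul1l hA b) key.
have [p' [pr pl]] : invertible mulB oneB (phi oneA).
  (* Indeed [phi 1 psi (a0 b0) = phi a0 psi b0], whose inverse is [b0' a0']; the left inverse of
     [psi 1] below is symmetric. *)
  apply: hBfin; left; exists (mulB (psi (mulA a0 b0)) (mulB b0' a0')).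
  by rewrite mA -key1 key -mA (mA (psi b0)) b0r m1l a0r.
have [q' [qr ql]] : invertible mulB oneB (psi oneA).
  apply: hBfin; right; exists (mulB (mulB b0' a0') (phi (mulA a0 b0))).
  by rewrite -mA key mA -(mA b0') a0l m1r b0l.
exists (fun a => mulB p' (phi a)); split; last split.
- split=> [c x y|x y].
    by have [lphi _] := hphi; rewrite lphi (cs_mulDr hB) (cs_mulZr hB).
  (* Multiplicativity: [phi (x y) = phi x psi y q'] by [key], and [psi y = p' phi y psi 1], so
     [psi 1] cancels against [q']. *)
  have -> : mulB p' (phi (mulA x y)) = mulB (mulB p' (mulB (phi x) (psi y))) q'.
    by rewrite -key mA -mA qr m1r.
  have -> : psi y = mulB (mulB p' (phi y)) (psi oneA).
    by rewrite -mA key1 mA pl m1l.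
  by rewrite !mA -mA qr m1r.
- by move=> a; rewrite mA pr m1l.
by move=> a; rewrite -mA key1 mA pl m1l.
Qed.
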